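(* Let $v$ be a Llull matrix on a finite set $A$ in the complete case, i.e. $v_{xy}+v_{yx}=1$ for all $x\ne y$ in $A$. Let $A=X\cup Y$ be a partition of $A$ into two disjoint nonempty sets. Let $(r_x)_{x\in A}$ be the rank-like rates determined by $v$, and let $(\tilde r_x)_{x\in X}$ and $(\tilde r_y)_{y\in Y}$ be the rank-like rates determined respectively by the restricted matrices $(v_{x\bar x})_{x,\bar x\in X}$ (a Llull matrix on $X$) and $(v_{y\bar y})_{y,\bar y\in Y}$ (a Llull matrix on $Y$). Then the following three conditions are equivalent: (i) $r_x=\tilde r_x$ for all $x\in X$; (ii) $r_y=\tilde r_y+|X|$ for all $y\in Y$; (iii) $v_{xy}=1$ for all $x\in X$ and $y\in Y$.
   Context: Let $A$ be a finite set with $N\ge1$ elements and $\Pi$ the set of ordered pairs $xy$ with $x,y\in A$, $x\ne y$. A relation on $A$ is a subset of $\Pi$. A Llull matrix on $A$ is a family $v=(v_{xy})_{xy\in\Pi}$ with $v_{xy}\in[0,1]$ and $v_{xy}+v_{yx}\le1$. Turnovers: $t_{xy}=v_{xy}+v_{yx}$. Indirect scores: $v^*_{xy}=\max\min_{0\le i<n}v_{x_ix_{i+1}}$, the max being over all paths $x_0x_1\dots x_n$ ($n\ge1$, consecutive elements distinct) with $x_0=x$, $x_n=y$. Put $m^\nu_{xy}=v^*_{xy}-v^*_{yx}$, $\nu=\{xy\in\Pi: m^\nu_{xy}>0\}$, $\hat\nu=\{xy\in\Pi: m^\nu_{xy}\ge0\}$. An admissible order is a (strict) total order $\xi\subseteq\Pi$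 with $\nu\subseteq\xi\subseteq\hat\nu$; one always exists. Write $x\succ y$ for $xy\in\xi$, $x\succeq y$ for $x\succ y$ or $x=y$, and $x'$ for the immediate successor of $x$ in $\xi$ (for $x$ not last). Given an admissible order $\xi$, the projected scores are obtained as follows. (i) For $x\succ y$: $m^\sigma_{xy}=\min\{m^\nu_{pq}: p\succeq x,\ y\succeq q\}$. (ii) $(t^\sigma_{xy})_{xy\in\Pi}$ is the unique minimizer of $\sum_{xy\in\Pi}(\tau_{xy}-t_{xy})^2$ among all real families $(\tau_{xy})_{xy\in\Pi}$ such that $\tau_{xy}=\tau_{yx}$ for all $xy$; $m^\sigma_{xx'}\le\tau_{xx'}\le1$ for all non-last $x$; $0\le\tau_{xy}-\tau_{xy'}\le m^\sigma_{yy'}$ for all non-last $y$ and all $x\notin\{y,y'\}$. (In the complete case this gives $t^\sigma_{xy}=1$ for all $xy$.) (iii) $\gamma_{xx'}=[(t^\sigma_{xx'}-m^\sigma_{xx'})/2,\ (t^\sigma_{xx'}+m^\sigma_{xx'})/2]$, and for $x\succ y$, $\gamma_{xy}=\bigcup\{\gamma_{pp'}: x\succeq p\succ y\}$, which is a closed interval. (iv) For $x\succ y$: $v^\pi_{xy}=\max\gamma_{xy}$, $v^\pi_{yx}=\min\gamma_{xy}$. The projected scores do not depend on the choice of $\xi$. Rank-like rates: $r_x=N-\sum_{y\ne x}v^\pi_{xy}$ (so $r_x=1$ if $A=\{x\}$). For a Llull matrix on a subset of $A$ the same procedure is applied with $A$ replaced by that subset and $N$ by its cardinality. *)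

(* Defs.v *)
From mathcomp Require Import all_boot all_order all_algebra.
From mathcomp Require Import classical_sets reals.

Set Implicit Arguments.
Unset Strict Implicit.
Unset Printing Implicit Defensive.

Import Order.TTheory GRing.Theory Num.Theory.

Local Open Scope classical_set_scope.
Local Open Scope ring_scope.

(* A family indexed by the pairs of distinct elements of A is encoded as a
   function A -> A -> R whose diagonal values are irrelevant: none of the
   notions below depends on them. *)

Definition llull_matrix (R : realType) (A : finType) (v : A -> A -> R) : Prop :=
  forall x y : A, x != y -> 0 <= v x y <= 1 /\ v x y + v y x <= 1.

Definition complete (R : realType) (A : finType) (v : A -> A -> R) : Prop :=
  forall x y : A, x != y -> v x y + v y x = 1.

Definition restriction (R : realType) (A : finType) (v : A -> A -> R)
    (X : {set A}) : {x : A | x \in X} -> {x : A | x \in X} -> R :=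
  fun x y => v (val x) (val y).
Arguments restriction {R A} v X _ _.

Section IndirectScores.
Context (R : realType) (A : finType) (v : A -> A -> R).

Definition turnover (x y : A) : R := v x y + v y x.

(* The path x_0 x_1 ... x_n is encoded by x_0 and the sequence x_1 ... x_n. *)
Definition is_path (x y : A) (s : seq A) : bool :=
  [&& (0 < size s)%N, path (fun a b => a != b) x s & last x s == y].

(* The initial value v x_0 x_1 is itself one of the terms of the minimum. *)
Definition path_score (x : A) (s : seq A) : R :=
  \big[Num.min/v x (head x s)]_(i < size s)
    v (nth x (x :: s) i) (nth x (x :: s) i.+1).

(* For x != y the set is nonempty, and it is finite, being contained in the
   set of the entries of v; so the supremum is a maximum. *)
Definition indirect_score (x y : A) : R :=
  sup [set path_score x s | s in [set s | is_path x y s]].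

Definition mnu (x y : A) : R := indirect_score x y - indirect_score y x.

Definition nu : rel A := fun x y => (x != y) && (0 < mnu x y).

Definition nu_hat : rel A := fun x y => (x != y) && (0 <= mnu x y).

End IndirectScores.

Definition strict_total_order (A : finType) (xi : rel A) : Prop :=
  [/\ irreflexive xi, transitive xi & forall x y, x != y -> xi x y || xi y x].

Definition admissible (R : realType) (A : finType) (v : A -> A -> R)
    (xi : rel A) : Prop :=
  [/\ strict_total_order xi, subrel (nu v) xi & subrel xi (nu_hat v)].

Section ProjectedScores.
Context (R : realType) (A : finType) (v : A -> A -> R) (xi : rel A).

Definition xi_eq : rel A := fun x y => (x == y) || xi x y.

Definition next_in (x x' : A) : bool :=
  xi x x' && [forall z, ~~ (xi x z && xi z x')].

(* Meaningful for xi x y only; the initial value mnu v x y is the term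
   (p, q) = (x, y) of the minimum. *)
Definition msigma (x y : A) : R :=
  \big[Num.min/mnu v x y]_(pq : A * A | xi_eq pq.1 x && xi_eq y pq.2)
    mnu v pq.1 pq.2.

Definition feasible (tau : A -> A -> R) : Prop :=
  [/\ forall x y, x != y -> tau x y = tau y x,
      forall x x', next_in x x' -> msigma x x' <= tau x x' <= 1
    & forall x y y', next_in y y' -> x != y -> x != y' ->
        0 <= tau x y - tau x y' <= msigma y y'].

Definition deviation (tau : A -> A -> R) : R :=
  \sum_(p : A * A | p.1 != p.2) (tau p.1 p.2 - turnover v p.1 p.2) ^+ 2.

Definition projected_turnover (t : A -> A -> R) : Prop :=
  feasible t /\ forall tau, feasible tau -> deviation t <= deviation tau.

Definition gamma (t : A -> A -> R) (x y : A) : set R :=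
  \bigcup_(pp in [set pp : A * A |
             [/\ next_in pp.1 pp.2, xi_eq x pp.1 & xi pp.1 y]])
    [set z : R | (t pp.1 pp.2 - msigma pp.1 pp.2) / 2 <= z
                 <= (t pp.1 pp.2 + msigma pp.1 pp.2) / 2].

(* For an admissible order, gamma is a nonempty finite union of closed bounded intervals,
   so sup and inf are its maximum and minimum. *)
Definition projected_score (t : A -> A -> R) (x y : A) : R :=
  if xi x y then sup (gamma t x y) else inf (gamma t y x).

End ProjectedScores.

(* Stated as a relation, so that every admissible order is allowed; the
   minimizer t is unique off the diagonal, where alone it is used. *)
Definition rank_like_rates (R : realType) (A : finType) (v : A -> A -> R)
    (r : A -> R) : Prop :=
  exists (xi : rel A) (t : A -> A -> R),
    [/\ admissible v xi, projected_turnover v xi t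
      & forall x, r x = #|A|%:R - \sum_(y | y != x) projected_score v xi t x y].

(* Main.v *)
(* In the complete case the projected turnovers are all 1, so every interval
   gamma is centred at 1/2 and v^pi_xy = (1 + M)/2 for x before y, where M is
   the largest m^sigma_pp' with p in [x, y[.  A consecutive pair pp' is a cut
   of A, and a cut whose margins m^nu are all positive is respected by every
   admissible order; hence M is the largest threshold at which some cut
   separates x from y, which makes the scores independent of the order.
   Under (iii) no path of positive score enters X from Y, so m^nu restricts to
   X and to Y, and so do the separating cuts (add X to a cut of Y).
   Conversely, complementary scores sum to 1, so summing (i) over X or (ii)
   over Y shows that all scores v^pi_xy between X and Y are 1; then
   m^nu_xy = 1, which forces v_xy = 1. *)

Require Import Defs.
From mathcomp Require Import classical_sets.
From mathcomp Require Import all_boot all_order all_algebra.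
From mathcomp Require Import reals.
From mathcomp Require Import lra.

Set Implicit Arguments.
Unset Strict Implicit.
Unset Printing Implicit Defensive.

Import Order.TTheory GRing.Theory Num.Theory.

Local Open Scope ring_scope.

(** * Indirect scores as reachability, and separation by cuts *)

Section IndirectScoreTheory.
Context (R : realType) (A : finType) (v : A -> A -> R).
Hypothesis llull_v : llull_matrix v.

Definition stronger_than (c : R) : rel A := fun a b => (a != b) && (c < v a b).

Lemma path_score_le1 x y s : is_path x y s -> path_score v x s <= 1.
Proof.
case: s => [|a s] // /and3P[_ /= /andP[xa _] _].
apply: le_trans (bigmin_le_id _ _ _ _) _ => /=.
by have [/andP[]] := llull_v xa.
Qed.

Lemma path_scores_nonempty x y : x != y ->
  ([set path_score v x s | s in [set s | is_path x y s]] !=set0)%classic.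
Proof.
by move=> xy; exists (path_score v x [:: y]), [:: y]; rewrite //= /is_path /= xy eqxx.
Qed.

(** The supremum exceeds [c] exactly when some path has all its links above [c], so max-min scores
    become reachability in a threshold graph. *)
Lemma indirect_score_gtE c x y : x != y ->
  (c < indirect_score v x y) = connect (stronger_than c) x y.
Proof.
move=> xy; apply/idP/idP.
  case/(sup_gt (path_scores_nonempty xy)) => _ [s sP <-].
  case/bigmin_gtP => _ cs; case/and3P: sP => _ /(pathP x) dist /eqP lasts.
  apply/connectP; exists s => //; apply/(pathP x) => i si.
  by apply/andP; split; [exact: dist|exact: (cs (Ordinal si))].
case/connectP => s sc lasts.
have s_gt0 : (0 < size s)%N.
  by case: s lasts {sc} => // lasts; rewrite lasts eqxx in xy.
have sP : is_path x y s.
  rewrite /is_path s_gt0 lasts eqxx andbT /=.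
  by apply: sub_path sc => a b /andP[].
apply: (@lt_le_trans _ _ (path_score v x s)).
  move/(pathP x): sc => sc; apply/bigmin_gtP; split=> [|i _].
    by case/andP: (sc 0%N s_gt0); case: (s) s_gt0.
  by case/andP: (sc i (ltn_ord i)).
apply: ub_le_sup; last by exists s.
by exists 1 => _ [u uP <-]; exact: path_score_le1 uP.
Qed.

Lemma indirect_score_ge x y : x != y -> v x y <= indirect_score v x y.
Proof.
move=> xy; rewrite leNgt; apply/negP => lt_v.
(* At the threshold [indirect_score v x y] the left side is false, while the single edge would make
   the right side true. *)
have := indirect_score_gtE (indirect_score v x y) xy.
rewrite ltxx => /esym/negP; apply; apply: connect1.
by rewrite /stronger_than xy.
Qed.

Lemma indirect_score_itv x y : x != y -> 0 <= indirect_score v x y <= 1.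
Proof.
move=> xy; apply/andP; split.
  by apply: le_trans (indirect_score_ge xy); have [/andP[]] := llull_v xy.
apply: ge_sup (path_scores_nonempty xy) _ => _ [u uP <-].
exact: path_score_le1 uP.
Qed.

Lemma mnuC x y : mnu v y x = - mnu v x y.
Proof. by rewrite /mnu opprB. Qed.

Lemma mnu_le1 x y : x != y -> mnu v x y <= 1.
Proof.
move=> xy; have := indirect_score_itv xy.
have yx : y != x by rewrite eq_sym.
have := indirect_score_itv yx; rewrite /mnu; lra.
Qed.

(* The largest threshold at which a cut puts x on its winning side and y on
   its losing side (0 if there is none); unlike the projected scores, it does
   not refer to any admissible order. *)
Definition separation (x y : A) : R :=
  \big[Num.max/0]_(L : {set A} | (x \in L) && (y \notin L))
    \big[Num.min/mnu v x y]_(pq : A * A | (pq.1 \in L) && (pq.2 \notin L))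
      mnu v pq.1 pq.2.

Lemma separation_ge0 x y : 0 <= separation x y.
Proof. exact: bigmax_ge_id. Qed.

(** Positivity of [c] excludes the default value 0 of the maximum, so a value at least [c] comes
    from an actual cut. *)
Lemma separation_geP c x y : 0 < c ->
  (exists L : {set A}, [/\ x \in L, y \notin L &
     forall p q, p \in L -> q \notin L -> c <= mnu v p q]) <->
  c <= separation x y.
Proof.
move=> c_gt0; split=> [[L [xL yL cL]]|].
  apply: (bigmax_sup L); first by rewrite xL.
  apply/bigmin_geP; split=> [|[p q] /andP[]]; exact: cL.
rewrite leNgt => /bigmax_ltP cS.
have [/existsP[L /andP[/andP[xL yL] cL]]|] := boolP [exists L : {set A},
  ((x \in L) && (y \notin L)) &&
  (c <= \big[Num.min/mnu v x y]_(pq | (pq.1 \in L) && (pq.2 \notin L))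
      mnu v pq.1 pq.2)].
  exists L; split=> // p q pL qL.
  by case/bigmin_geP: cL => _ /(_ (p, q)); rewrite /= pL qL; apply.
rewrite negb_exists => /forallP noL; case: cS; split=> // L xyL.
by have := noL L; rewrite xyL /= -ltNge.
Qed.

Lemma separation_mnu c x y : 0 < c -> c <= separation x y -> c <= mnu v x y.
Proof.
move=> c_gt0 /(separation_geP _ _ c_gt0)[L [xL yL]]; exact.
Qed.

Lemma separation_eq0 x y : mnu v x y <= 0 -> separation x y = 0.
Proof.
move=> m_le0; apply/eqP; rewrite eq_le separation_ge0 andbT leNgt.
apply/negP => /[dup] s_gt0 /separation_mnu/(_ (lexx _)); lra.
Qed.

Lemma separation_le1 x y : x != y -> separation x y <= 1.
Proof.
move=> xy; have [s_gt0|] := ltrP 0 (separation x y); last by lra.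
exact: le_trans (separation_mnu s_gt0 (lexx _)) (mnu_le1 xy).
Qed.

(** Margins are antisymmetric, so at most one of the two separations is nonzero: this is (1 + M)/2
    for the winner and (1 - M)/2 for the loser. *)
Definition separation_score x y := (1 + separation x y - separation y x) / 2.

Lemma separation_scoreC x y : separation_score x y + separation_score y x = 1.
Proof. rewrite /separation_score; lra. Qed.

Lemma separation_score_le1 x y : x != y -> separation_score x y <= 1.
Proof.
move=> xy; have := separation_le1 xy; have := separation_ge0 y x.
rewrite /separation_score; lra.
Qed.

Lemma separation_score_ge0 x y : x != y -> 0 <= separation_score x y.
Proof.
move=> xy; have yx : y != x by rewrite eq_sym.
have := separation_score_le1 yx; have := separation_scoreC x y; lra.
Qed.

(** Score 1 forces separation 1 and margin 1, hence indirect score 0 from [y] to [x]; then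
    [v y x = 0] and completeness concludes. *)
Lemma separation_score_eq1 x y : x != y -> complete v ->
  separation_score x y = 1 -> v x y = 1.
Proof.
move=> xy complete_v s1.
have s_ge1 : 1 <= separation x y.
  have := separation_ge0 y x; move: s1; rewrite /separation_score; lra.
have := separation_mnu ltr01 s_ge1.
have yx : y != x by rewrite eq_sym.
have := indirect_score_itv xy; have := indirect_score_ge yx.
have := complete_v _ _ xy; have [] := llull_v xy; have [] := llull_v yx.
rewrite /mnu; lra.
Qed.

End IndirectScoreTheory.

(** * Cuts of a strict total order and adjacent pairs *)

Section StrictTotalOrder.
Context (A : finType) (xi : rel A).
Hypothesis xi_order : strict_total_order xi.

Lemma xi_irr a : xi a a = false. Proof. by case: xi_order. Qed.

Lemma xi_trans : transitive xi. Proof. by case: xi_order. Qed.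

Lemma xi_neq a b : xi a b -> a != b.
Proof. by apply: contraTneq => ->; rewrite xi_irr. Qed.

Lemma xi_total a b : a != b -> xi a b || xi b a.
Proof. by case: xi_order => _ _; apply. Qed.

Lemma xi_asym a b : xi a b -> xi b a -> False.
Proof. by move=> ab /(xi_trans ab); rewrite xi_irr. Qed.

Lemma xi_eqNgt a b : xi_eq xi a b = ~~ xi b a.
Proof.
apply/idP/idP => [/orP[/eqP ->|ab]|ba]; first by rewrite xi_irr.
  by apply/negP => /(xi_asym ab).
rewrite /xi_eq; have [//|/= ab] := eqVneq a b.
by have := xi_total ab; rewrite (negPf ba) orbF.
Qed.

Lemma xi_eq_trans a b c : xi_eq xi a b -> xi b c -> xi a c.
Proof. by case/orP => [/eqP -> //|]; exact: xi_trans. Qed.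

Lemma xi_trans_eq a b c : xi a b -> xi_eq xi b c -> xi a c.
Proof. by move=> ab /orP[/eqP <- //|]; exact: xi_trans. Qed.

Definition rank (a : A) : nat := #|[set b | xi b a]|.

Lemma rank_lt a b : xi a b -> (rank a < rank b)%N.
Proof.
move=> ab; apply: proper_card; apply/properP; split.
  by apply/fintype.subsetP => c; rewrite !inE => /xi_trans; apply.
by exists a; rewrite !inE // xi_irr.
Qed.

(* The last element of an up-closed set and the first one outside of it. *)
Lemma cut_adjacent (L : {set A}) x y : x \in L -> y \notin L ->
  (forall a b, b \in L -> a \notin L -> xi b a) ->
  exists p p', [/\ next_in xi p p', forall a, xi_eq xi a p = (a \in L) &
    forall b, xi_eq xi p' b = (b \notin L)].
Proof.
move=> xL yL cutL.
case: (arg_maxnP rank xL) => p /= pL pmax.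
case: (@arg_minnP _ y (fun b => b \notin L) rank yL) => p' /= p'L p'min.
have eLp a : xi_eq xi a p = (a \in L).
  rewrite xi_eqNgt; apply/idP/idP; first by apply: contraNT => /(cutL _ _)->.
  by move/pmax; apply: contraL => /rank_lt; rewrite -ltnNge.
have eLp' b : xi_eq xi p' b = (b \notin L).
  rewrite xi_eqNgt; apply/idP/idP; first by apply: contraNN => /cutL->.
  by move/p'min; apply: contraL => /rank_lt; rewrite -ltnNge.
exists p, p'; split=> //; rewrite /next_in cutL //; apply/forallP => z.
apply/negP => /andP[pz zp']; have := eLp z; have := eLp' z.
by rewrite !xi_eqNgt pz zp'; case: (z \in L).
Qed.

End StrictTotalOrder.

(** * Projected scores in the complete case *)

Section ProjectedScoreTheory.
Context (R : realType) (A : finType) (v : A -> A -> R).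
Context (xi : rel A) (t : A -> A -> R).
Hypothesis llull_v : llull_matrix v.
Hypothesis complete_v : complete v.
Hypothesis xi_adm : admissible v xi.
Hypothesis t_proj : projected_turnover v xi t.

Let xi_order : strict_total_order xi. Proof. by case: xi_adm. Qed.

Lemma mnu_gt0_xi x y : 0 < mnu v x y -> xi x y.
Proof.
move=> m_gt0; have [_ + _] := xi_adm; apply; rewrite /nu m_gt0 andbT.
by apply: contraTneq m_gt0 => ->; rewrite /mnu subrr ltxx.
Qed.

Lemma xi_mnu_ge0 x y : xi x y -> 0 <= mnu v x y.
Proof. by have [_ _ /[apply]/andP[]] := xi_adm. Qed.

Lemma msigma_ge0 x y : xi x y -> 0 <= msigma v xi x y.
Proof.
move=> xy; apply/bigmin_geP; split=> [|[p q] /= /andP[px yq]].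
  exact: xi_mnu_ge0.
apply/xi_mnu_ge0/(xi_trans_eq xi_order _ yq).
exact: (xi_eq_trans xi_order px).
Qed.

Lemma msigma_le1 x y : xi x y -> msigma v xi x y <= 1.
Proof.
move=> /(xi_neq xi_order) xy.
exact: le_trans (bigmin_le_id _ _ _ _) (mnu_le1 llull_v xy).
Qed.

(** The constant family 1 is feasible with deviation 0, because all turnovers are 1; so the
    minimizer has deviation 0 and each square vanishes. *)
Lemma projected_turnover_complete x y : x != y -> t x y = 1.
Proof.
move=> xy; have [t_feas t_min] := t_proj.
have feas1 : feasible v xi (fun _ _ => 1).
  split=> // [a b /andP[ab _]|_ a b /andP[ab _] _ _].
    by rewrite lexx msigma_le1.
  by rewrite subrr lexx msigma_ge0.
have dev1 : deviation v (fun _ _ => 1) = 0.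
  apply: big1 => -[a b] /= ab.
  by rewrite /turnover complete_v // subrr expr0n.
have : deviation v t == 0.
  by rewrite eq_le -{1}dev1 t_min //= sumr_ge0 // => p _; exact: sqr_ge0.
rewrite psumr_eq0 => [/allP/(_ (x, y))|p _]; last exact: sqr_ge0.
rewrite mem_index_enum /= xy sqrf_eq0 /turnover complete_v // subr_eq0.
by move=> /(_ isT)/eqP.
Qed.

(** The initial segment ending at [p] is a cut separating [x] from [y], and every pair across it is
    a term of the minimum defining [msigma]. *)
Lemma msigma_le_separation x y p p' : next_in xi p p' -> xi_eq xi x p ->
  xi p y -> msigma v xi p p' <= separation v x y.
Proof.
move=> /andP[pp' /forallP between] xp py.
have [m_gt0|] := ltrP 0 (msigma v xi p p'); last first.
  by move=> /le_trans; apply; exact: separation_ge0.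
apply/separation_geP => //; exists [set a | xi_eq xi a p].
rewrite !inE xp [xi_eq xi y p](xi_eqNgt xi_order) py; split=> // a b.
rewrite !inE => ap; rewrite xi_eqNgt // negbK => pb.
(* Nothing lies strictly between [p] and [p']. *)
have p'b : xi_eq xi p' b.
  by rewrite xi_eqNgt //; have := between b; rewrite pb.
by apply: (@bigmin_le_cond _ _ _ _ (a, b)); rewrite /= ap.
Qed.

(** An optimal cut with positive margins is an initial segment of [xi], so its boundary is an
    adjacent pair. *)
Lemma separation_attained x y : xi x y -> exists p p',
  [/\ next_in xi p p', xi_eq xi x p, xi p y &
      msigma v xi p p' = separation v x y].
Proof.
move=> xy; set s := separation v x y.
have [L [xL yL cutL sL]] : exists L : {set A}, [/\ x \in L, y \notin L,
    forall a b, b \in L -> a \notin L -> xi b a &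
    forall p q, p \in L -> q \notin L -> s <= mnu v p q].
  have [s_gt0|s_le0] := ltrP 0 s.
    have [L [xL yL sL]] := (separation_geP v x y s_gt0).2 (lexx _).
    exists L; split=> // a b bL aL.
    by apply: mnu_gt0_xi; exact: lt_le_trans (sL _ _ bL aL).
  (* For separation 0 any initial segment works, its margins being nonnegative; the one ending at
     [x] is taken. *)
  have cutL a b : b \in [set a | xi_eq xi a x] ->
      a \notin [set a | xi_eq xi a x] -> xi b a.
    rewrite !inE => bx; rewrite xi_eqNgt // negbK.
    exact: (xi_eq_trans xi_order).
  exists [set a | xi_eq xi a x]; split=> //.
  - by rewrite inE /xi_eq eqxx.
  - by rewrite inE xi_eqNgt // xy.
  - move=> p q pL qL; apply: (le_trans s_le0).
    exact/xi_mnu_ge0/cutL.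
have [p [p' [pp' Lp Lp']]] := cut_adjacent xi_order xL yL cutL.
have xp : xi_eq xi x p by rewrite Lp.
have py : xi p y by have := Lp y; rewrite (negPf yL) xi_eqNgt // => /negbFE.
exists p, p'; split=> //; apply/eqP; rewrite eq_le msigma_le_separation //=.
apply/bigmin_geP; split=> [|[a b] /=]; last first.
  by rewrite Lp Lp' => /andP[]; exact: sL.
by apply: sL; [rewrite -Lp|rewrite -Lp']; rewrite /xi_eq eqxx.
Qed.

Lemma gammaE x y z : gamma v xi t x y z <-> exists p p',
  [/\ next_in xi p p', xi_eq xi x p, xi p y &
    (1 - msigma v xi p p') / 2 <= z <= (1 + msigma v xi p p') / 2].
Proof.
have t1 p p' : next_in xi p p' -> t p p' = 1.
  by move=> /andP[/(xi_neq xi_order)/projected_turnover_complete].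
split=> [[[p p'] [/= pp' xp py]]|[p [p' [pp' xp py z_in]]]].
  by rewrite /mkset /= t1 // => z_in; exists p, p'.
by exists (p, p'); rewrite /mkset //= t1.
Qed.

Lemma gamma_sup x y : xi x y ->
  sup (gamma v xi t x y) = (1 + separation v x y) / 2.
Proof.
move=> xy; have [p [p' [pp' xp py sE]]] := separation_attained xy.
have s_ge0 := separation_ge0 v x y.
have top : gamma v xi t x y ((1 + separation v x y) / 2).
  by apply/gammaE; exists p, p'; split=> //; rewrite sE; lra.
have bound : ubound (gamma v xi t x y) ((1 + separation v x y) / 2).
  move=> z /gammaE[q [q' [qq' xq qy]]].
  by have := msigma_le_separation qq' xq qy; lra.
apply/eqP; rewrite eq_le ge_sup //; last by exists ((1 + separation v x y) / 2).
by apply: ub_le_sup => //; exists ((1 + separation v x y) / 2).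
Qed.

Lemma gamma_inf x y : xi x y ->
  inf (gamma v xi t x y) = (1 - separation v x y) / 2.
Proof.
move=> xy; have [p [p' [pp' xp py sE]]] := separation_attained xy.
have s_ge0 := separation_ge0 v x y.
have bot : gamma v xi t x y ((1 - separation v x y) / 2).
  by apply/gammaE; exists p, p'; split=> //; rewrite sE; lra.
have bound : lbound (gamma v xi t x y) ((1 - separation v x y) / 2).
  move=> z /gammaE[q [q' [qq' xq qy]]].
  by have := msigma_le_separation qq' xq qy; lra.
apply/eqP; rewrite eq_le lb_le_inf ?andbT //; last first.
  by exists ((1 - separation v x y) / 2).
by apply: ge_inf => //; exists ((1 - separation v x y) / 2).
Qed.

(** The right side involves neither [xi] nor [t]; the separation against the order vanishes, that
    margin being at most 0. *)
Lemma projected_scoreE x y : x != y ->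
  projected_score v xi t x y = separation_score v x y.
Proof.
move=> xy; rewrite /projected_score /separation_score.
case: ifPn => [xy_xi|].
  rewrite gamma_sup // (@separation_eq0 _ _ _ y x) ?subr0 //.
  by rewrite mnuC oppr_le0 xi_mnu_ge0.
rewrite -xi_eqNgt // /xi_eq eq_sym (negPf xy) /= => yx_xi.
rewrite gamma_inf // (@separation_eq0 _ _ _ x y) ?addr0 //.
by rewrite mnuC oppr_le0 xi_mnu_ge0.
Qed.

End ProjectedScoreTheory.

(** * Rates from separation scores, and tools on sums, reachability and thresholds *)

Lemma rank_like_ratesE (R : realType) (A : finType) (v : A -> A -> R) r :
  llull_matrix v -> complete v -> rank_like_rates v r ->
  forall x, r x = #|A|%:R - \sum_(y | y != x) separation_score v x y.
Proof.
move=> llull_v complete_v [xi [t [adm proj rE]]] x; rewrite rE.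
by congr (_ - _); apply: eq_bigr => y yx; apply: projected_scoreE; rewrite // eq_sym.
Qed.

(* Adding the double sum to its transpose pairs s a b with s b a. *)
Lemma sum_complementary (R : realFieldType) (A : finType) (s : A -> A -> R)
    (Z : {set A}) : (forall a b, s a b + s b a = 1) ->
  \sum_(a in Z) \sum_(b in Z | b != a) s a b = #|Z|%:R * (#|Z|%:R - 1) / 2.
Proof.
move=> sC; set S := \sum_(a in Z) _.
have ST : S = \sum_(a in Z) \sum_(b in Z | b != a) s b a.
  rewrite /S [RHS](exchange_big_dep (mem Z)) /= => [|a b _ /andP[] //].
  apply: eq_bigr => a aZ; apply: eq_bigl => b.
  by rewrite aZ /= eq_sym.
have : S + S = #|Z|%:R * (#|Z|%:R - 1).
  rewrite {2}ST -big_split /= (eq_bigr (fun _ => #|Z|%:R - 1)).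
    by rewrite sumr_const mulr_natl.
  move=> a aZ; rewrite -big_split /= (eq_bigr (fun _ => 1)) => [|b _]; last exact: sC.
  rewrite sumr_const (cardsD1 a Z) aZ natrD addrC addKr.
  congr (_%:R); apply: eq_card => b.
  by rewrite in_setD1 unfold_in andbC.
lra.
Qed.

(** By convexity a path between two points of [Z] never leaves [Z], so it lifts to the subtype. *)
Lemma connect_relpre_val (A : finType) (e : rel A) (Z : {set A})
    (x y : {a | a \in Z}) :
  (forall a, connect e (val x) a -> connect e a (val y) -> a \in Z) ->
  connect (relpre val e) x y = connect e (val x) (val y).
Proof.
move=> convexZ; apply/idP/idP.
  move=> /connectP[s sP ->]; apply/connectP; exists (map val s).
    by rewrite path_map.
  by rewrite last_map.
move=> /connectP[s]; elim: s x convexZ => [|a s IHs] x convexZ /=.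
  by move=> _ /val_inj ->.
move=> /andP[xa sa] lasts.
have aZ : a \in Z.
  by apply: convexZ; [exact: connect1|apply/connectP; exists s].
apply: (connect_trans (y := exist _ a aZ)); first exact: connect1.
apply: IHs => //= b ab; apply: convexZ.
exact: connect_trans (connect1 xa) ab.
Qed.

Lemma eq_ge0_threshold (R : realDomainType) (a b : R) : 0 <= a -> 0 <= b ->
  (forall c, 0 <= c -> (c < a) = (c < b)) -> a = b.
Proof.
move=> a0 b0 ab; apply/eqP; rewrite eq_le.
by have := ab a a0; have := ab b b0; rewrite !ltxx !leNgt => -> <-.
Qed.

(** * Restricted matrices *)

Section Restriction.
Context (R : realType) (A : finType) (v : A -> A -> R) (Z : {set A}).

Lemma restriction_llull : llull_matrix v -> llull_matrix (restriction v Z).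
Proof. by move=> llull_v x y xy; apply: llull_v; rewrite (inj_eq val_inj). Qed.

Lemma restriction_complete : complete v -> complete (restriction v Z).
Proof. by move=> complete_v x y xy; apply: complete_v; rewrite (inj_eq val_inj). Qed.

End Restriction.

(** * Consequences of [X] dominating its complement *)

Section Dominance.
Context (R : realType) (A : finType) (v : A -> A -> R) (X : {set A}).
Hypothesis llull_v : llull_matrix v.
Hypothesis complete_v : complete v.
Hypothesis domX : forall x y, x \in X -> y \notin X -> v x y = 1.

Let crossing_neq x y : x \in X -> y \notin X -> x != y.
Proof. by move=> xX; apply: contraNneq => <-. Qed.

(** By completeness an edge entering [X] from outside has value 0, which does not exceed [c]. *)
Lemma dominated_closed c x y : 0 <= c -> x \notin X ->
  connect (stronger_than v c) x y -> y \notin X.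
Proof.
move=> c0 xX /connectP[s sP ->]; elim: s x xX sP => //= a s IHs x xX.
case/andP => /andP[xa ca]; apply: IHs; apply/negP => aX.
have := complete_v xa; rewrite (domX aX xX) => vxa.
move: ca; lra.
Qed.

Lemma dominance_mnu x y : x \in X -> y \notin X -> mnu v x y = 1.
Proof.
move=> xX yX; have xy := crossing_neq xX yX.
have yx : y != x by rewrite eq_sym.
have s_le0 : indirect_score v y x <= 0.
  rewrite leNgt; apply/negP; rewrite indirect_score_gtE //.
  by move=> /(dominated_closed (lexx _) yX); rewrite xX.
have := indirect_score_itv llull_v xy; have := indirect_score_itv llull_v yx.
have := indirect_score_ge llull_v xy; rewrite domX // /mnu; lra.
Qed.

(** The set [X] is itself a cut all of whose margins are 1. *)
Lemma dominance_score x y : x \in X -> y \notin X -> separation_score v x y = 1.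
Proof.
move=> xX yX; have mxy := dominance_mnu xX yX.
have := separation_le1 llull_v (crossing_neq xX yX).
have : 1 <= separation v x y.
  apply/separation_geP => //; exists X; split=> // p q pX qX.
  by rewrite dominance_mnu.
have : separation v y x = 0 by apply: separation_eq0; rewrite mnuC mxy; lra.
rewrite /separation_score; lra.
Qed.

Variable Z : {set A}.
Hypothesis Z_side : Z = X \/ Z = ~: X.

Let mem_side : (forall a, (a \in Z) = (a \in X)) \/
  (forall a, (a \in Z) = (a \notin X)).
Proof. by case: Z_side => ->; [left|right] => // a; rewrite inE. Qed.

Lemma dominance_indirect_score (x y : {a | a \in Z}) : x != y ->
  indirect_score (restriction v Z) x y = indirect_score v (val x) (val y).
Proof.
move=> xy; have vxy : val x != val y by rewrite (inj_eq val_inj).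
have llull_Z := restriction_llull llull_v (Z := Z).
apply: eq_ge0_threshold => [||c c0].
- by have /andP[] := indirect_score_itv llull_Z xy.
- by have /andP[] := indirect_score_itv llull_v vxy.
rewrite !indirect_score_gtE // -connect_relpre_val => [|a xa ay].
  by apply: eq_connect => a b /=; rewrite /stronger_than (inj_eq val_inj).
(* Convexity of [Z]: for [Z = X] it follows from the path [a] to [y], for the complement from the
   path [x] to [a]. *)
have := dominated_closed c0 _ xa; have := dominated_closed c0 _ ay.
have := valP x; have := valP y.
case: mem_side => Z_X; rewrite !Z_X => yX xX; last by move=> _; apply.
by move=> + _; case: (a \in X) => // /(_ isT); rewrite yX.
Qed.

Lemma dominance_mnu_restriction (x y : {a | a \in Z}) :
  mnu (restriction v Z) x y = mnu v (val x) (val y).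
Proof.
have [->|xy] := eqVneq x y; first by rewrite /mnu !subrr.
by rewrite /mnu !dominance_indirect_score // eq_sym.
Qed.

Lemma dominance_separation (x y : {a | a \in Z}) : x != y ->
  separation (restriction v Z) x y = separation v (val x) (val y).
Proof.
move=> xy; have vxy : val x != val y by rewrite (inj_eq val_inj).
have le_of c : 0 < c -> c <= separation (restriction v Z) x y <->
    c <= separation v (val x) (val y).
  move=> c0; split; last first.
    move/(separation_geP _ _ _ c0) => [L [xL yL cL]].
    apply/separation_geP => //; exists [set z | val z \in L].
    rewrite !inE; split=> // p q; rewrite !inE dominance_mnu_restriction.
    exact: cL.
  move=> /[dup] c_le /(separation_geP _ _ _ c0)[L [xL yL cL]].
  (* Needed for pairs from [X] to its complement, whose margin is exactly 1. *)
  have c1 : c <= 1.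
    apply: (le_trans c_le); apply: separation_le1 => //.
    exact: restriction_llull.
  apply/separation_geP => //.
  (* This is [L] when [Z = X], and the union of [L] and [X] when [Z] is the complement. *)
  exists [set a | if insub a is Some z then z \in L else a \in X].
  rewrite !inE !valK; split=> // p q; rewrite !inE.
  case: insubP => [p' _ <-|pZ]; case: insubP => [q' _ <-|qZ].
  - by move=> pL qL; rewrite -dominance_mnu_restriction; exact: cL.
  - move=> _ qX; rewrite dominance_mnu //.
    by have := valP p'; move: qZ; case: mem_side => Z_X; rewrite !Z_X ?(negPf qX).
  - move=> pX _; rewrite dominance_mnu //.
    by have := valP q'; move: pZ; case: mem_side => Z_X; rewrite !Z_X ?pX.
  - by move=> pX qX; rewrite dominance_mnu.
apply/eqP; rewrite eq_le; apply/andP; split.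
  have [s0|/le_trans] := ltrP 0 (separation (restriction v Z) x y).
    by apply/le_of.
  by apply; exact: separation_ge0.
have [s0|/le_trans] := ltrP 0 (separation v (val x) (val y)).
  by apply/le_of.
by apply; exact: separation_ge0.
Qed.

End Dominance.

(** * Comparing the rates on [A] with those on one side *)

Section Rates.
Context (R : realType) (A : finType) (v : A -> A -> R) (Z : {set A}).
Context (r : A -> R) (rZ : {a | a \in Z} -> R).
Hypothesis llull_v : llull_matrix v.
Hypothesis complete_v : complete v.
Hypothesis r_rates : rank_like_rates v r.
Hypothesis rZ_rates : rank_like_rates (restriction v Z) rZ.

Let s := separation_score v.

Lemma rate_split a : a \in Z -> r a =
  #|Z|%:R + #|~: Z|%:R - \sum_(b in Z | b != a) s a b - \sum_(b in ~: Z) s a b.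
Proof.
move=> aZ; rewrite (rank_like_ratesE llull_v complete_v r_rates).
rewrite -(cardsC Z) natrD (bigID (mem Z)) /= opprD addrA; congr (_ - _ - _).
  by apply: eq_bigl => b; rewrite andbC.
apply: eq_bigl => b; rewrite inE andbC; case: (boolP (b \in Z)) => //= bZ.
by apply: contraNneq bZ => ->.
Qed.

Lemma card_side : #|{: {a | a \in Z}}| = #|Z|.
Proof. by rewrite card_sig; apply: eq_card. Qed.

(** Summed over [Z], the internal scores contribute |Z|(|Z| - 1)/2 both in [A] and in [Z], so they
    cancel and only cross scores remain. *)
Lemma cross_score_sum k : (forall z, r (val z) = rZ z + k) ->
  \sum_(a in Z) \sum_(b in ~: Z) s a b = #|Z|%:R * (#|~: Z|%:R - k).
Proof.
move=> rk.
have sumA : \sum_(a in Z) r a = #|Z|%:R * (#|Z|%:R + #|~: Z|%:R)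
    - #|Z|%:R * (#|Z|%:R - 1) / 2 - \sum_(a in Z) \sum_(b in ~: Z) s a b.
  rewrite (eq_bigr _ rate_split) !sumrB sumr_const mulr_natl.
  by rewrite sum_complementary //; exact: separation_scoreC.
have sumZ : \sum_z rZ z = #|Z|%:R * #|Z|%:R - #|Z|%:R * (#|Z|%:R - 1) / 2.
  rewrite (eq_bigr _ (fun z _ => rank_like_ratesE (restriction_llull llull_v)
    (restriction_complete complete_v) rZ_rates z)).
  rewrite sumrB sumr_const mulr_natl card_side; congr (_ - _).
  rewrite -{1 2}card_side -cardsT.
  rewrite -(sum_complementary _ (separation_scoreC (restriction v Z))).
  by apply: eq_big => [z|z _]; [rewrite inE|apply: eq_bigl => b; rewrite inE].
have : \sum_(a in Z) r a = \sum_z rZ z + #|Z|%:R * k.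
  rewrite big_sub (eq_bigr _ (fun z _ => rk z)) big_split /= sumr_const.
  by rewrite card_side mulr_natl.
rewrite sumA sumZ; lra.
Qed.

(** Dominance makes the internal scores agree one by one, leaving only the cross scores of [z]. *)
Lemma rate_shift (X : {set A}) : (forall x y, x \in X -> y \notin X -> v x y = 1) ->
  Z = X \/ Z = ~: X -> forall z,
  r (val z) = rZ z + (#|~: Z|%:R - \sum_(b in ~: Z) s (val z) b).
Proof.
move=> domX Z_side z; rewrite rate_split ?(valP z) //.
rewrite (rank_like_ratesE (restriction_llull llull_v)
  (restriction_complete complete_v) rZ_rates) card_side big_sub_cond.
rewrite (eq_bigl (fun w => w != z)) => [|w]; last first.
  by rewrite -(inj_eq val_inj).
rewrite (eq_bigr (separation_score (restriction v Z) z)) => [|w wz]; first by lra.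
rewrite /s /separation_score !(dominance_separation llull_v complete_v domX) //.
by rewrite eq_sym.
Qed.

End Rates.

(** * Vanishing double sums and the equivalence *)

Lemma psumr2_eq0 (R : realDomainType) (A : finType) (P Q : pred A)
    (f : A -> A -> R) :
  (forall a b, P a -> Q b -> 0 <= f a b) ->
  \sum_(a | P a) \sum_(b | Q b) f a b = 0 ->
  forall a b, P a -> Q b -> f a b = 0.
Proof.
move=> f0 sum0 a b Pa Qb.
have row0 := psumr_eq0P (fun a Pa => sumr_ge0 _ (fun b Qb => f0 a b Pa Qb)) sum0.
exact: (psumr_eq0P (fun b Qb => f0 a b Pa Qb) (row0 a Pa)).
Qed.

Theorem theorem14p3 (R : realType) (A : finType) (v : A -> A -> R)
    (X Y : {set A})
    (r : A -> R) (rX : {x : A | x \in X} -> R) (rY : {y : A | y \in Y} -> R) :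
  llull_matrix v -> complete v ->
  X :|: Y = [set: A] -> [disjoint X & Y] -> X != set0 -> Y != set0 ->
  rank_like_rates v r ->
  rank_like_rates (restriction v X) rX ->
  rank_like_rates (restriction v Y) rY ->
  ((forall x : {x : A | x \in X}, r (val x) = rX x) <->
   (forall y : {y : A | y \in Y}, r (val y) = rY y + #|X|%:R)) /\
  ((forall y : {y : A | y \in Y}, r (val y) = rY y + #|X|%:R) <->
   (forall x y : A, x \in X -> y \in Y -> v x y = 1)).
Proof.
move=> llull_v complete_v XY disjXY _ _ r_rates rX_rates rY_rates.
have eY : Y = ~: X.
  apply/setP => a; rewrite inE; have := in_setT a; rewrite -XY inE.
  have := disjoint_setI0 disjXY; move/setP/(_ a); rewrite !inE.
  by case: (a \in X); case: (a \in Y).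
subst Y; set s := separation_score v.
have crossing_neq x y : x \in X -> y \in ~: X -> x != y.
  by move=> xX; rewrite inE; apply: contraNneq => <-.
have dom1 : (forall x y, x \in X -> y \in ~: X -> s x y = 1) ->
    forall x y, x \in X -> y \in ~: X -> v x y = 1.
  move=> s1 x y xX yX.
  exact: separation_score_eq1 (crossing_neq _ _ xX yX) complete_v (s1 _ _ xX yX).
have iii_of_i : (forall x, r (val x) = rX x) ->
    forall x y, x \in X -> y \in ~: X -> v x y = 1.
  move=> ri; apply: dom1 => x y xX yX; apply/eqP; rewrite eq_sym -subr_eq0.
  (* With shift 0 the cross scores sum to the number of cross pairs, so the nonnegative deficits 1 -
     s sum to 0. *)
  have /(cross_score_sum llull_v complete_v r_rates rX_rates) cross :
    forall x, r (val x) = rX x + 0 by move=> z; rewrite addr0.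
  apply/eqP; move: x y xX yX; apply: psumr2_eq0 => [x y xX yX|].
    by rewrite subr_ge0 separation_score_le1 // crossing_neq.
  under eq_bigr => a _ do rewrite sumrB sumr_const.
  by rewrite sumrB cross sumr_const subr0 mulr_natl subrr.
have iii_of_ii : (forall y, r (val y) = rY y + #|X|%:R) ->
    forall x y, x \in X -> y \in ~: X -> v x y = 1.
  move=> rii; apply: dom1 => x y xX yX.
  have := separation_scoreC v x y.
  suff -> : separation_score v y x = 0 by rewrite addr0.
  (* With shift |X| the nonnegative scores from the complement to [X] sum to 0. *)
  have := cross_score_sum llull_v complete_v r_rates rY_rates rii.
  rewrite setCK subrr mulr0 => /psumr2_eq0; apply=> // a b aX bX.
  by apply: separation_score_ge0 => //; rewrite eq_sym crossing_neq.
have i_of_iii : (forall x y, x \in X -> y \in ~: X -> v x y = 1) ->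
    forall x, r (val x) = rX x.
  move=> iii x; have domX a b : a \in X -> b \notin X -> v a b = 1.
    by move=> aX bX; apply: iii => //; rewrite inE.
  rewrite (rate_shift llull_v complete_v r_rates rX_rates domX) //; last by left.
  rewrite (eq_bigr (fun _ => 1)) => [|b]; first by rewrite sumr_const subrr addr0.
  by rewrite inE; exact: (dominance_score llull_v complete_v domX (valP x)).
have ii_of_iii : (forall x y, x \in X -> y \in ~: X -> v x y = 1) ->
    forall y, r (val y) = rY y + #|X|%:R.
  move=> iii y; have domX a b : a \in X -> b \notin X -> v a b = 1.
    by move=> aX bX; apply: iii => //; rewrite inE.
  rewrite (rate_shift llull_v complete_v r_rates rY_rates domX) //; last by right.
  (* Scores from the complement to [X] vanish, so the whole shift |X| remains. *)
  rewrite setCK big1 ?subr0 // => b bX.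
  have := separation_scoreC v b (val y); have := valP y; rewrite inE => yX.
  rewrite (dominance_score llull_v complete_v domX bX yX); lra.
by split; split; auto.
Qed.
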